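(* Let $n\ge 0$ be an integer and let $R$ be an $n$-coherent commutative ring. Then the following conditions are equivalent. (A) $R$ is a $G$-$(n,0)$-ring. (B) The following conditions hold: (1) Every finitely generated proper ideal of $R$ has a nonzero annihilator. (2) For each infinitely presented $R$-module $M$, $\mathrm{Gpd}_R(M)<\infty$. (3) For every finitely generated Gorenstein projective submodule $G$ of a finitely generated projective $R$-module $P$, the quotient $P/G$ is Gorenstein projective.
   Context: All rings are commutative with identity and all modules are unital. An $R$-module $M$ is Gorenstein projective if there is an exact sequence of projective modules $\mathbf P=\cdots\to P_1\to P_0\to P^0\to P^1\to\cdots$ with $M\cong \mathrm{Im}(P_0\to P^0)$ such that $\mathrm{Hom}_R(-,Q)$ leaves $\mathbf P$ exact for every projective module $Q$. $\mathrm{Gpd}_R(M)$ is the minimal length of a resolution of $M$ by Gorenstein projective modules ($\infty$ if there is no finite one). For an integer $n\ge 0$, an $R$-module $M$ is $n$-presented if there is an exact sequence $F_n\to F_{n-1}\to\cdots\to F_0\to M\to 0$ with each $F_i$ a finitely generated free $R$-module; $M$ is infinitely presented if it is $n$-presented for every $n$. $R$ is $n$-coherent if every $n$-presented $R$-module is $(n+1)$-presented. For integers $n,d\ge 0$, $R$ is a $G$-$(n,d)$-ring if every $n$-presented $R$-module $M$ satisfies $\mathrm{Gpd}_R(M)\le d$. *)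

(* Defs.v *)
From HB Require Import structures.
From mathcomp Require Import all_boot all_order all_algebra.
From mathcomp Require Import generic_quotient ring_quotient.
From mathcomp Require Import boolp.

Set Implicit Arguments.
Unset Strict Implicit.
Unset Printing Implicit Defensive.

Import GRing.Theory.
Local Open Scope ring_scope.
Local Open Scope quotient_scope.

(* [comPzRingType] rather than [comNzRingType]: the zero ring is allowed. *)

Section SubmoduleAndQuotient.
Variables (R : comPzRingType) (M : lmodType R) (N : submodClosed M).

Definition submod : Type := {x : M | x \in N}.
HB.instance Definition _ := SubChoice.on submod.
HB.instance Definition _ := [SubChoice_isSubLmodule of submod by <:].

(* [submodClosed] does not inherit from [zmodClosed]; the closure under
   opposites that the quotient group needs comes from scaling by -1. *)
Definition submod_pred : pred M := fun x => x \in N.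

Lemma submod_pred_closed : submod_closed submod_pred.
Proof. exact: (submodClosedP N). Qed.

HB.instance Definition _ :=
  GRing.isSubmodClosed.Build R M submod_pred submod_pred_closed.

Definition submod_zmod : zmodClosed M := GRing.ZmodClosed.clone M submod_pred _.

Definition quotmod : Type := Quotient.quot submod_zmod.
HB.instance Definition _ := GRing.Zmodule.on quotmod.

Definition quotmod_proj (x : M) : quotmod :=
  \pi_(Quotient.quot submod_zmod) x.

Lemma quotmod_projP x y : reflect (quotmod_proj x = quotmod_proj y) (x - y \in N).
Proof.
apply: (iffP idP) => [h|/eqP h].
  by apply/eqP; rewrite -(Quotient.idealrBE submod_zmod).
by move: h; rewrite -(Quotient.idealrBE submod_zmod).
Qed.

Lemma quotmod_proj_surj (q : quotmod) : exists x, quotmod_proj x = q.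
Proof. by exists (repr q); rewrite /quotmod_proj reprK. Qed.

Lemma quotmod_projD : {morph quotmod_proj : x y / x + y}.
Proof. by move=> x y; exact: Quotient.pi_add. Qed.

Definition quotmod_scale (a : R) (q : quotmod) : quotmod :=
  quotmod_proj (a *: repr q).

Lemma quotmod_projZ a x : quotmod_proj (a *: x) = quotmod_scale a (quotmod_proj x).
Proof.
apply/quotmod_projP; rewrite -scalerBr rpredZ //.
by apply/quotmod_projP; rewrite /quotmod_proj reprK.
Qed.

Lemma quotmod_scaleA a b q :
  quotmod_scale a (quotmod_scale b q) = quotmod_scale (a * b) q.
Proof. by have [x <-] := quotmod_proj_surj q; rewrite -!quotmod_projZ scalerA. Qed.

Lemma quotmod_scale1 : left_id 1 quotmod_scale.
Proof.
by move=> q; have [x <-] := quotmod_proj_surj q; rewrite -quotmod_projZ scale1r.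
Qed.

Lemma quotmod_scaleDr : right_distributive quotmod_scale +%R.
Proof.
move=> a p q; have [x <-] := quotmod_proj_surj p.
have [y <-] := quotmod_proj_surj q.
by rewrite -quotmod_projD -!quotmod_projZ scalerDr quotmod_projD.
Qed.

Lemma quotmod_scaleDl q : {morph quotmod_scale^~ q : a b / a + b}.
Proof.
move=> a b; have [x <-] := quotmod_proj_surj q.
by rewrite -!quotmod_projZ scalerDl quotmod_projD.
Qed.

HB.instance Definition _ := GRing.Zmodule_isLmodule.Build R quotmod
  quotmod_scaleA quotmod_scale1 quotmod_scaleDr quotmod_scaleDl.

Lemma quotmod_proj_is_linear : linear quotmod_proj.
Proof. by move=> a x y; rewrite quotmod_projD quotmod_projZ. Qed.

HB.instance Definition _ :=
  GRing.isLinear.Build R M quotmod _ quotmod_proj quotmod_proj_is_linear.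

End SubmoduleAndQuotient.

Section Notions.
Variable R : comPzRingType.
Implicit Types A B C M P Q F : lmodType R.

Definition surjective A B (f : A -> B) : Prop := forall y, exists x, f x = y.

Definition finitely_generated M : Prop :=
  exists (m : nat) (e : 'I_m -> M),
    forall x, exists c : 'I_m -> R, x = \sum_(i < m) c i *: e i.

Definition fg_free F : Prop :=
  exists (m : nat) (phi : {linear 'rV[R]_m -> F}), bijective phi.

Definition projective P : Prop :=
  forall A B (g : {linear A -> B}) (f : {linear P -> B}),
    surjective g -> exists h : {linear P -> A}, forall x, g (h x) = f x.

Definition exact_at A B C (f : {linear A -> B}) (g : {linear B -> C}) : Prop :=
  forall y, g y = 0 <-> exists x, f x = y.

(* Exactness of Hom(C, Q) -> Hom(B, Q) -> Hom(A, Q) at the middle term. *)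
Definition hom_exact_at Q A B C (f : {linear A -> B}) (g : {linear B -> C}) :
    Prop :=
  forall h : {linear B -> Q},
    (forall x, h (f x) = 0) <->
    exists k : {linear C -> Q}, forall y, k (g y) = h y.

(* ... -> lterm 1 -> lterm 0 -> rterm 0 -> rterm 1 -> ..., that is,
   P_i = lterm i and P^i = rterm i; [middiff] is P_0 -> P^0. *)
Record biseq := Biseq {
  lterm : nat -> lmodType R;
  rterm : nat -> lmodType R;
  ldiff : forall i, {linear lterm i.+1 -> lterm i};
  middiff : {linear lterm 0 -> rterm 0};
  rdiff : forall i, {linear rterm i -> rterm i.+1} }.

Definition at_each_term
    (E : forall A B C, {linear A -> B} -> {linear B -> C} -> Prop)
    (X : biseq) : Prop :=
  [/\ forall i, E _ _ _ (ldiff X i.+1) (ldiff X i),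
      E _ _ _ (ldiff X 0) (middiff X),
      E _ _ _ (middiff X) (rdiff X 0) &
      forall i, E _ _ _ (rdiff X i) (rdiff X i.+1)].

(* M ~ Im f is expressed by an embedding of M in B with the same image as f. *)
Definition iso_to_image M A B (f : {linear A -> B}) : Prop :=
  exists phi : {linear M -> B},
    injective phi /\ forall y, (exists z, phi z = y) <-> (exists x, f x = y).

Definition Gorenstein_projective M : Prop :=
  exists X : biseq,
    [/\ (forall i, projective (lterm X i)) /\ (forall i, projective (rterm X i)),
        at_each_term exact_at X,
        forall Q, projective Q -> at_each_term (hom_exact_at Q) X &
        iso_to_image M (middiff X)].

(* 0 -> G_d -> ... -> G_0 -> M -> 0, continued by zero beyond G_d. *)
Definition Gproj_resolution M (d : nat) : Prop :=
  exists (G : nat -> lmodType R) (del : forall i, {linear G i.+1 -> G i})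
         (e : {linear G 0 -> M}),
    [/\ forall i, Gorenstein_projective (G i),
        forall i, (d < i)%N -> forall x : G i, x = 0,
        surjective e,
        exact_at (del 0) e &
        forall i, exact_at (del i.+1) (del i)].

(* [None] stands for infinity. *)
Definition Gpd M : option nat :=
  match pselect (exists d, `[< Gproj_resolution M d >]) with
  | left ex_res => Some (ex_minn ex_res)
  | right _ => None
  end.

Definition Gpd_le M (d : nat) : Prop :=
  if Gpd M is Some k then (k <= d)%N else False.

Definition Gpd_finite M : Prop := Gpd M <> None.

(* F and del are unconstrained past index n and index n - 1 respectively. *)
Definition n_presented (n : nat) M : Prop :=
  exists (F : nat -> lmodType R) (del : forall i, {linear F i.+1 -> F i})
         (e : {linear F 0 -> M}),
    [/\ forall i, (i <= n)%N -> fg_free (F i),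
        surjective e,
        (0 < n)%N -> exact_at (del 0) e &
        forall i, (i.+1 < n)%N -> exact_at (del i.+1) (del i)].

Definition infinitely_presented M : Prop := forall n, n_presented n M.

End Notions.

Definition n_coherent (R : comPzRingType) (n : nat) : Prop :=
  forall M : lmodType R, n_presented n M -> n_presented n.+1 M.

Definition G_ring (R : comPzRingType) (n d : nat) : Prop :=
  forall M : lmodType R, n_presented n M -> Gpd_le M d.

(* Ideals of R are the submodules of the regular module [R^o]. *)
Definition is_proper_ideal (R : comPzRingType) (I : submodClosed R^o) : Prop :=
  exists x : R^o, x \notin I.

Definition has_nonzero_annihilator (R : comPzRingType) (I : submodClosed R^o) :
    Prop :=
  exists a : R, a <> 0 /\ forall x : R, (x : R^o) \in I -> a * x = 0.

(* Main.v *)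
From HB Require Import structures.
Require Import Defs.
From mathcomp Require Import all_boot all_order all_algebra boolp functions.
Import GRing.Theory.
Local Open Scope ring_scope.

(** The engine is a description of Gorenstein projective modules that never
    mentions a two-sided complex.  They form the largest class X of modules
    such that every M in X satisfies Ext^1(M, Q) = 0 for all projective Q, is a
    quotient of a projective by a member of X, and embeds in a projective with
    cokernel in X: splicing the short exact sequences obtained from the last
    two properties gives the complex, and the first property is exactly what
    keeps it exact under Hom(-, Q).  So a module is shown to be Gorenstein
    projective by exhibiting such a class ([Gproj_coinduction]).  This yields
    stability under extensions ([Gproj_extension]), removal of a projective
    summand ([Gproj_summand]), kernels of epimorphisms ([Gproj_kernel]), and
    the criterion that P / G is Gorenstein projective when P is projective, G
    is Gorenstein projective and Ext^1(P / G, -) vanishes on projectives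
    ([Gproj_cokernel]).

    Suppose that n-presented modules are Gorenstein projective.  If a finitely
    generated proper ideal (a_1, ..., a_m) had zero annihilator, the map
    R -> R^m with entries a_i would be injective, with a cokernel that has a
    finite free resolution and is therefore Gorenstein projective; hence the
    identity of R would extend to R^m, which puts 1 in the ideal.  For (3), the
    point is that over an n-coherent ring a finitely generated Gorenstein
    projective module G is n-presented ([Gproj_fg_presented]).  A finitely
    generated submodule of a projective module sees only finitely many
    coordinates, so G embeds in some R^m with a cokernel that is again finitely
    generated and Gorenstein projective.  After j such steps the cokernel is
    j-presented; at j = n coherence makes it k-presented for every k, and
    Schanuel's lemma carries this back to G.

    Conversely, let M be n-presented, hence k-presented for every k, and of
    Gorenstein projective dimension at most d.  The d-th syzygy of M in a
    resolution by finitely generated free modules is Gorenstein projective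
    ([Gdim_syzygy]), and (3) climbs back along the resolution to M
    ([finite_Gdim_Gproj]). *)

Section Ring.
Context {R : comPzRingType}.
Implicit Types A B C D F G K L M N P Q X Y : lmodType R.

(** * Linear maps, submodules and short exact sequences *)

Lemma linear_of_function A B (f : A -> B) :
  linear f -> exists g : {linear A -> B}, forall x, g x = f x.
Proof.
move=> lin_f; pose fM := GRing.isLinear.Build R A B _ f lin_f.
by pose g : {linear A -> B} := HB.pack f fM; exists g.
Qed.

(** Most maps between kernels and cokernels below are only known through an
    equation that determines their values; this turns such an equation into a
    linear map. *)
Lemma linear_of_relation A B (T : A -> B -> Prop) :
  (forall x, exists y, T x y) ->
  (forall a x x' y y', T x y -> T x' y' -> T (a *: x + x') (a *: y + y')) ->
  (forall y, T 0 y -> y = 0) ->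
  exists f : {linear A -> B}, forall x y, T x y <-> f x = y.
Proof.
move=> totT linT T0; have [f fT] := choice totT.
have T_uniq x y y' : T x y -> T x y' -> y = y'.
  move=> Ty Ty'; apply/esym/eqP; rewrite -subr_eq0; apply/eqP/T0.
  by have := linT (-1) _ _ _ _ Ty Ty'; rewrite !scaleN1r addNr [X in T 0 X]addrC.
suff /linear_of_function[g gE] : linear f.
  exists g => x y; rewrite gE; split=> [|<- //]; exact: T_uniq.
by move=> a x y; apply: T_uniq (fT _) _; apply: linT.
Qed.

(** Kernels and images are predicates in Prop, while a [submodClosed] is a
    boolean predicate.  The section [Bundle] converts the former into the
    latter. *)
Definition is_submodule M (S : M -> Prop) : Prop :=
  S 0 /\ forall a x y, S x -> S y -> S (a *: x + y).

Section Bundle.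
Context {M : lmodType R} (S : M -> Prop) (subS : is_submodule M S).

Definition bundle_pred : pred M := fun x => `[< S x >].

Lemma bundle_pred_closed : submod_closed bundle_pred.
Proof.
case: subS => S0 SD; split; first exact/asboolP.
by move=> a x y /asboolP Sx /asboolP Sy; apply/asboolP/SD.
Qed.

(* The proof is an argument so that the instance below can be keyed on it. *)
Definition bundle_as_closed (_ : is_submodule M S) := bundle_pred.
HB.instance Definition _ :=
  GRing.isSubmodClosed.Build R M (bundle_as_closed subS) bundle_pred_closed.
Definition bundle : submodClosed M :=
  GRing.SubmodClosed.clone R M (bundle_as_closed subS) _.

Lemma in_bundle x : (x \in bundle) <-> S x.
Proof. by split=> [/asboolP|Sx]; last exact/asboolP. Qed.

End Bundle.

Definition ses {A B C} (i : {linear A -> B}) (p : {linear B -> C}) : Prop :=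
  [/\ injective i, exact_at i p & surjective p].

Lemma linear_injP A B (f : {linear A -> B}) :
  (forall x, f x = 0 -> x = 0) -> injective f.
Proof.
move=> f0 x y fxy; apply/eqP; rewrite -subr_eq0; apply/eqP/f0.
by rewrite linearB fxy subrr.
Qed.

Lemma linear_inj0 {A B} {f : {linear A -> B}} :
  injective f -> forall x, f x = 0 -> x = 0.
Proof. by move=> injf x fx0; apply: injf; rewrite fx0 linear0. Qed.

Lemma exact_comp0 {A B C} {i : {linear A -> B}} {p : {linear B -> C}} :
  exact_at i p -> forall x, p (i x) = 0.
Proof. by move=> ex x; apply/ex; exists x. Qed.

(** A submodule is used only through an injective map with the prescribed
    image, so that no later argument depends on how it is constructed. *)
Lemma submodule_embedding M (S : M -> Prop) : is_submodule M S ->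
  exists K (i : {linear K -> M}), injective i /\ forall y, S y <-> exists x, i x = y.
Proof.
move=> subS; exists (submod (bundle S subS)), (val : {linear submod _ -> M}).
split; first exact: val_inj.
move=> y; split=> [Sy|[x <-]]; last exact/in_bundle/(valP x).
have yS : y \in bundle S subS by apply/in_bundle.
by exists (Sub y yS).
Qed.

Lemma submodule_ses M (G : submodClosed M) :
  ses (val : {linear submod G -> M}) (quotmod_proj G : {linear M -> quotmod G}).
Proof.
split; [exact: val_inj | | exact: quotmod_proj_surj].
move=> y; split=> [|[x <-]].
  rewrite -(linear0 (quotmod_proj G)) => /quotmod_projP; rewrite subr0 => yG.
  by exists (Sub y yG).
rewrite -(linear0 (quotmod_proj G)); apply/quotmod_projP; rewrite subr0.
exact: (valP x).
Qed.

Lemma kernel_submodule B C (p : {linear B -> C}) : is_submodule B (fun y => p y = 0).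
Proof.
by split=> [|a x y px py]; rewrite ?linear0 // linearP px py scaler0 addr0.
Qed.

Lemma image_submodule A B (i : {linear A -> B}) :
  is_submodule B (fun y => exists x, i x = y).
Proof.
split; first by exists 0; rewrite linear0.
by move=> a _ _ [x <-] [y <-]; exists (a *: x + y); rewrite linearP.
Qed.

Lemma kernel_ses {B C} (p : {linear B -> C}) : surjective p ->
  exists K (i : {linear K -> B}), ses i p.
Proof.
move=> surjp; have [K [i [inji iE]]] := submodule_embedding _ _ (kernel_submodule _ _ p).
by exists K, i.
Qed.

Lemma cokernel_ses {A B} (i : {linear A -> B}) : injective i ->
  exists C (p : {linear B -> C}), ses i p.
Proof.
move=> inji; pose G := bundle _ (image_submodule _ _ i).
have [_ exG surj] := submodule_ses _ G.
exists (quotmod G), (quotmod_proj G : {linear B -> quotmod G}); split=> // y.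
have inG : y \in G <-> exists x, i x = y by exact: in_bundle.
split=> [/exG[[x xG] yE]|/inG yG]; first by apply/inG; rewrite -yE.
by apply/exG; exists (Sub y yG).
Qed.

Lemma factor_injection {A B C} (i : {linear B -> C}) (f : {linear A -> C}) :
  injective i -> (forall x, exists y, i y = f x) ->
  exists g : {linear A -> B}, forall x, i (g x) = f x.
Proof.
move=> inji fi.
have [//|a x x' y y' iy iy'|y|g gE] :=
  linear_of_relation _ _ (fun x y => i y = f x).
- by rewrite !linearP iy iy'.
- by rewrite linear0; apply: linear_inj0.
by exists g => x; apply/gE.
Qed.

Lemma factor_surjection {A B C} (p : {linear A -> B}) (f : {linear A -> C}) :
  surjective p -> (forall x, p x = 0 -> f x = 0) ->
  exists g : {linear B -> C}, forall x, g (p x) = f x.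
Proof.
move=> surjp pf.
have [y||y [x [/pf fx <-]] //|g gE] := linear_of_relation _ _
    (fun y z => exists x, p x = y /\ f x = z).
- by have [x <-] := surjp y; exists (f x), x.
- move=> a _ _ _ _ [x [<- <-]] [x' [<- <-]].
  by exists (a *: x + x'); rewrite !linearP.
by exists g => x; apply/gE; exists x.
Qed.

Lemma inverse_linear {A B} (f : {linear A -> B}) :
  injective f -> surjective f ->
  exists g : {linear B -> A}, cancel f g /\ cancel g f.
Proof.
move=> injf surjf.
have [g fg] := factor_injection f (idfun : {linear B -> B}) injf surjf.
by exists g; split=> // x; apply: injf; rewrite fg.
Qed.

(** * Projective modules and the vanishing of Ext^1 *)

Lemma projective_prod P Q : projective P -> projective Q ->
  projective (P * Q)%type.
Proof.
move=> prP prQ A B g f surjg.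
have [u uE] := linear_of_function _ (P * Q)%type (fun x : P => (x, 0))
  ltac:(by move=> a x y; congr pair; rewrite /= ?scaler0 ?addr0).
have [v vE] := linear_of_function _ (P * Q)%type (fun y : Q => (0, y))
  ltac:(by move=> a x y; congr pair; rewrite /= ?scaler0 ?addr0).
have [h1 h1E] := prP _ _ g (f \o u) surjg.
have [h2 h2E] := prQ _ _ g (f \o v) surjg.
exists ((h1 \o fst) \+ (h2 \o snd)) => -[x y] /=.
rewrite linearD h1E h2E /= -linearD uE vE; congr (f _).
by congr pair; rewrite /= ?addr0 ?add0r.
Qed.

Lemma linear_of_row {M} {m} (e : 'I_m -> M) :
  exists f : {linear 'rV[R]_m -> M},
    forall v, f v = \sum_(i < m) v ord0 i *: e i.
Proof.
apply: linear_of_function => a u v; rewrite scaler_sumr -big_split /=.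
by apply: eq_bigr => i _; rewrite !mxE scalerDl scalerA.
Qed.

Lemma row_projective m : projective 'rV[R]_m.
Proof.
move=> A B g f surjg.
have [e eE] := choice (fun i => surjg (f (delta_mx ord0 i : 'rV_m))).
have [h hE] := linear_of_row e; exists h => v.
rewrite hE [v in RHS]row_sum_delta !linear_sum; apply: eq_bigr => i _.
by rewrite !linearZ /= eE.
Qed.

(** Ext^1(M, Q) = 0 for all projective Q, expressed through the connecting
    map: the restriction Hom(B, Q) -> Hom(A, Q) is onto for every extension B
    of M by any A.  No Ext group needs to be constructed. *)
Definition Ext1_vanishes M : Prop :=
  forall Q A B (i : {linear A -> B}) (p : {linear B -> M}),
    projective Q -> ses i p ->
    forall h : {linear A -> Q}, exists k : {linear B -> Q},
      forall x, k (i x) = h x.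

(** One projective presentation detects the vanishing of Ext^1.  Given another
    sequence 0 -> A -> B -> M -> 0, lift P -> M to [phi] : P -> B; every element
    of B is phi u + j a, and once h is extended from K to P by k the formula
    k u + h a is independent of the decomposition. *)
Lemma Ext1_of_presentation {K P M} {i : {linear K -> P}} {p : {linear P -> M}} :
  projective P -> ses i p ->
  (forall Q, projective Q -> forall h : {linear K -> Q},
    exists k : {linear P -> Q}, forall x, k (i x) = h x) ->
  Ext1_vanishes M.
Proof.
move=> prP [inji exip surjp] ext_i Q A B j q prQ [injj exjq surjq] h.
have [phi phiE] := prP _ _ q p surjq.
have [x|g gE] := factor_injection j (phi \o i) injj.
  by apply/exjq; rewrite /= phiE (exact_comp0 exip).
have [k kE] := ext_i Q prQ (h \o g).
have [b|a _ _ _ _ [u [x [-> ->]]] [u' [x' [-> ->]]]|z|k' k'E] :=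
  linear_of_relation B Q
    (fun b z => exists u x, b = phi u + j x /\ z = k u + h x).
- have [u pu] := surjp (q b).
  have /exjq[x jx] : q (b - phi u) = 0 by rewrite linearB /= phiE pu subrr.
  by exists (k u + h x), u, x; rewrite jx addrC subrK.
- by exists (a *: u + u'), (a *: x + x');
    rewrite !linearP !scalerDr; split; rewrite addrACA.
- move=> [u [x [phi_jx ->]]].
  have /exip[y iy] : p u = 0.
    rewrite -phiE -[RHS](linear0 q) phi_jx linearD (exact_comp0 exjq).
    by rewrite addr0.
  move: phi_jx; rewrite -iy -/((phi \o i) y) -gE -linearD => /esym.
  by rewrite kE /= -linearD => /(linear_inj0 injj) ->; rewrite linear0.
by exists k' => x; apply/k'E; exists 0, x; rewrite !linear0 !add0r.
Qed.

(** * Gorenstein projective modules as a coinductive class *)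

Lemma iso_Gorenstein_projective {M N : lmodType R} (f : {linear M -> N}) :
  injective f -> surjective f ->
  Gorenstein_projective N -> Gorenstein_projective M.
Proof.
move=> injf surjf [X [prX exX homX [phi [injphi imphi]]]].
exists X; split=> //; exists (phi \o f); split; first exact: inj_comp.
move=> y; rewrite -imphi; split=> [[x <-]|[z <-]]; first by exists (f x).
by have [x <-] := surjf z; exists x.
Qed.

(** Moving the middle of a complex by one place, to show that the kernel of
    P_0 -> M and the cokernel of M -> P^0 are Gorenstein projective too. *)
Definition prepend M (F : nat -> lmodType R) (i : nat) : lmodType R :=
  if i is j.+1 then F j else M.

Definition shift_left (X : biseq R) : biseq R := @Biseq R
  (fun i => lterm X i.+1)
  (prepend (lterm X 0) (rterm X))
  (fun i => ldiff X i.+1)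
  (ldiff X 0)
  (fun i => match i return {linear prepend (lterm X 0) (rterm X) i -> rterm X i}
     with 0 => middiff X | j.+1 => rdiff X j end).

Definition shift_right (X : biseq R) : biseq R := @Biseq R
  (prepend (rterm X 0) (lterm X))
  (fun i => rterm X i.+1)
  (fun i => match i return {linear lterm X i -> prepend (rterm X 0) (lterm X) i}
     with 0 => middiff X | j.+1 => ldiff X j end)
  (rdiff X 0)
  (fun i => rdiff X i.+1).

Lemma at_each_term_shift_left
    (E : forall A B C, {linear A -> B} -> {linear B -> C} -> Prop) (X : biseq R) :
  at_each_term E X -> at_each_term E (shift_left X).
Proof. by case=> El E0 E1 Er; split=> //= -[|i] /=. Qed.

Lemma at_each_term_shift_right
    (E : forall A B C, {linear A -> B} -> {linear B -> C} -> Prop) (X : biseq R) :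
  at_each_term E X -> at_each_term E (shift_right X).
Proof. by case=> El E0 E1 Er; split=> //= -[|i] /=. Qed.

(** The last clause is the vanishing of Ext^1: a map K -> Q restricts to a
    cocycle on P_1, which extends to P_0 because Hom(-, Q) is exact there. *)
Lemma Gproj_left {M} : Gorenstein_projective M ->
  exists K P (i : {linear K -> P}) (p : {linear P -> M}),
    [/\ Gorenstein_projective K, projective P, ses i p &
        forall Q, projective Q -> forall h : {linear K -> Q},
          exists k : {linear P -> Q}, forall x, k (i x) = h x].
Proof.
move=> [X [[prl prr] exX homX [phi [injphi imphi]]]].
have [el e0 e1 er] := exX.
have [x|e eE] := factor_injection phi (middiff X) injphi.
  by apply/imphi; exists x.
have surje : surjective e.
  move=> z; have /imphi[x xz] : exists w, phi w = phi z by exists z.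
  by exists x; apply: injphi; rewrite eE.
have [K [i [inji exie _]]] := kernel_ses e surje.
have ker_e y : e y = 0 <-> exists x, ldiff X 0 x = y.
  rewrite -e0 -eE; split=> [->|]; [exact: linear0|exact: linear_inj0].
have [x|r rE] := factor_injection i (ldiff X 0) inji.
  by apply/exie/ker_e; exists x.
exists K, (lterm X 0), i, e; split=> //.
- exists (shift_left X); split.
  + by split=> [j|[|j]] /=.
  + exact: at_each_term_shift_left.
  + by move=> Q prQ; apply: (at_each_term_shift_left _ _ (homX Q prQ)).
  + by exists i; split=> // y; rewrite -exie.
move=> Q prQ h; have [homl _ _ _] := homX Q prQ.
have [x|k kE] := (homl 0%N (h \o r)).1.
  suff rl : r (ldiff X 1 x) = 0 by rewrite /= rl linear0.
  by apply: (linear_inj0 inji); rewrite rE (exact_comp0 (el 0%N)).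
exists k => x; have /ker_e[y yE] := exact_comp0 exie x.
by rewrite -yE kE /=; congr (h _); apply: inji; rewrite rE.
Qed.

Lemma Gproj_right {M} : Gorenstein_projective M ->
  exists P C (i : {linear M -> P}) (p : {linear P -> C}),
    [/\ Gorenstein_projective C, projective P & ses i p].
Proof.
move=> [X [[prl prr] exX homX [phi [injphi imphi]]]].
have [el e0 e1 er] := exX.
have [C [c [injc cE]]] := submodule_embedding _ _ (image_submodule _ _ (rdiff X 0)).
have [x|p pE] := factor_injection c (rdiff X 0) injc.
  by apply/cE; exists x.
exists (rterm X 0), C, phi, p; split=> //.
  exists (shift_right X); split.
  + by split=> [[|j]|j] /=.
  + exact: at_each_term_shift_right.
  + by move=> Q prQ; apply: (at_each_term_shift_right _ _ (homX Q prQ)).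
  + by exists c; split=> // y; rewrite -cE.
split=> // [y|z].
  rewrite imphi -e1 -pE; split=> [->|]; [exact: linear0|exact: linear_inj0].
have /cE[x xz] : exists w, c w = c z by exists z.
by exists x; apply: injc; rewrite pE.
Qed.

Lemma Gproj_Ext1 M : Gorenstein_projective M -> Ext1_vanishes M.
Proof.
move=> /Gproj_left[K [P [i [p [_ prP ex ext_i]]]]].
exact: Ext1_of_presentation ex ext_i.
Qed.

Lemma splice_exact {K' K P M N} (r : {linear K' -> K}) (i : {linear K -> P})
    (p : {linear P -> M}) (j : {linear M -> N}) :
  surjective r -> exact_at i p -> injective j -> exact_at (i \o r) (j \o p).
Proof.
move=> surjr ex injj y; split=> [/(linear_inj0 injj)/ex[x <-]|[x <-]] /=.
  by have [z <-] := surjr x; exists z.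
by rewrite (exact_comp0 ex) linear0.
Qed.

(** A map on P killing the image of K factors through M, and then extends
    along j by hypothesis. *)
Lemma splice_hom_exact {Q K' K P M N} (r : {linear K' -> K}) (i : {linear K -> P})
    (p : {linear P -> M}) (j : {linear M -> N}) :
  surjective r -> ses i p ->
  (forall h : {linear M -> Q}, exists k : {linear N -> Q}, forall x, k (j x) = h x) ->
  hom_exact_at Q (i \o r) (j \o p).
Proof.
move=> surjr [_ ex surjp] ext_j h; split=> [hir|[k kE] x]; last first.
  by rewrite -kE /= (exact_comp0 ex) !linear0.
have [y /ex[x <-]|g gE] := factor_surjection p h surjp.
  by have [z <-] := surjr x; apply: hir.
by have [k kE] := ext_j g; exists k => y; rewrite /= kE gE.
Qed.

(** Iterating the two steps from M by dependent choice gives syzygies [Ls] and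
    cosyzygies [Rs], whose short exact sequences are spliced into a complex.
    All spliced monomorphisms have their cokernel in X, so the vanishing of
    Ext^1 makes the complex exact under Hom(-, Q). *)
Lemma Gproj_coinduction (X : lmodType R -> Prop) :
  (forall M, X M -> Ext1_vanishes M) ->
  (forall M, X M -> exists K P (i : {linear K -> P}) (p : {linear P -> M}),
     [/\ X K, projective P & ses i p]) ->
  (forall M, X M -> exists P C (i : {linear M -> P}) (p : {linear P -> C}),
     [/\ X C, projective P & ses i p]) ->
  forall M, X M -> Gorenstein_projective M.
Proof.
move=> extX leftX rightX M XM; pose T := {N : lmodType R | X N}.
have L (N : T) : {K : T & {P : lmodType R & {i : {linear sval K -> P} &
    {p : {linear P -> sval N} | projective P /\ ses i p}}}}.
  case: N => N XN /=; have /cid[K /cid[P /cid[i /cid[p [XK prP ex]]]]] := leftX N XN.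
  by exists (exist _ K XK), P, i, p.
have D (N : T) : {C : T & {P : lmodType R & {i : {linear sval N -> P} &
    {p : {linear P -> sval C} | projective P /\ ses i p}}}}.
  case: N => N XN /=; have /cid[P /cid[C /cid[i /cid[p [XC prP ex]]]]] := rightX N XN.
  by exists (exist _ C XC), P, i, p.
pose Ls n := iter n (fun N : T => projT1 (L N)) (exist _ M XM).
pose Rs n := iter n (fun N : T => projT1 (D N)) (exist _ M XM).
pose LP n := projT1 (projT2 (L (Ls n))).
pose Li n : {linear sval (Ls n.+1) -> LP n} := projT1 (projT2 (projT2 (L (Ls n)))).
pose Lp n : {linear LP n -> sval (Ls n)} :=
  sval (projT2 (projT2 (projT2 (L (Ls n))))).
have Lprop n : projective (LP n) /\ ses (Li n) (Lp n).
  by rewrite /Li /Lp /LP; case: (projT2 (projT2 (projT2 (L (Ls n))))).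
pose RP n := projT1 (projT2 (D (Rs n))).
pose Ri n : {linear sval (Rs n) -> RP n} := projT1 (projT2 (projT2 (D (Rs n)))).
pose Rp n : {linear RP n -> sval (Rs n.+1)} :=
  sval (projT2 (projT2 (projT2 (D (Rs n))))).
have Rprop n : projective (RP n) /\ ses (Ri n) (Rp n).
  by rewrite /Ri /Rp /RP; case: (projT2 (projT2 (projT2 (D (Rs n))))).
have [LPpr Lses] := all_and2 Lprop; have [RPpr Rses] := all_and2 Rprop.
have extL Q n : projective Q -> forall h : {linear sval (Ls n.+1) -> Q},
    exists k : {linear LP n -> Q}, forall x, k (Li n x) = h x.
  by move=> prQ; apply: (extX _ (svalP (Ls n)) _ _ _ (Li n) (Lp n)).
have extR Q n : projective Q -> forall h : {linear sval (Rs n) -> Q},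
    exists k : {linear RP n -> Q}, forall x, k (Ri n x) = h x.
  by move=> prQ; apply: (extX _ (svalP (Rs n.+1)) _ _ _ (Ri n) (Rp n)).
have [Linj Lex Lsurj] := all_and3 Lses; have [Rinj Rex Rsurj] := all_and3 Rses.
exists (@Biseq R LP RP (fun n => Li n \o Lp n.+1) (Ri 0%N \o Lp 0%N)
          (fun n => Ri n.+1 \o Rp n)); split=> //.
- by split=> *; apply: splice_exact.
- move=> Q prQ; split=> [n|||n]; apply: splice_hom_exact; by auto.
- exists (Ri 0%N); split=> // y; split=> -[x <-]; last by exists (Lp 0%N x).
  by have [z <-] := Lsurj 0%N x; exists z.
Qed.

Lemma zero_row (v : 'rV[R]_0) : v = 0.
Proof. by apply/rowP => -[]. Qed.

Lemma projective_Gproj P : projective P -> Gorenstein_projective P.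
Proof.
move: P; apply: Gproj_coinduction => P prP.
- move=> Q A B i p prQ [inji ex surjp] h.
  have [s sE] := prP _ _ p (idfun : {linear P -> P}) surjp.
  have [b|r rE] := factor_injection i (idfun \- (s \o p)) inji.
    by apply/ex; rewrite /= linearB sE subrr.
  exists (h \o r) => x /=; congr (h _); apply: inji.
  by rewrite rE /= (exact_comp0 ex) linear0 subr0.
- exists 'rV[R]_0, P, (\0 : {linear _ -> _}), (idfun : {linear _ -> _}).
  split=> //; first exact: row_projective.
  split=> [x y _||x]; first by rewrite (zero_row x) (zero_row y).
    move=> y; split=> [/= ->|[x <-]] //=; first by exists 0.
  by exists x.
- exists P, 'rV[R]_0, (idfun : {linear _ -> _}), (\0 : {linear _ -> _}).
  split=> //; first exact: row_projective.
  split=> // [y|x]; first by split=> // _; exists y.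
  by exists 0; rewrite (zero_row x).
Qed.

(** * Stability properties *)

Lemma linear_pair {A B C} (f : {linear A -> B}) (g : {linear A -> C}) :
  exists h : {linear A -> (B * C)%type}, forall x, h x = (f x, g x).
Proof.
by apply: linear_of_function => a x y; congr pair; rewrite /= linearP.
Qed.

(** A map on the bottom term X of an extension Y of B is extended in two steps:
    first to the preimage [Y'] of A in Y, an extension of A by X, and from there
    to Y, an extension of C by [Y']. *)
Lemma Ext1_extension {A B C} {i : {linear A -> B}} {p : {linear B -> C}} :
  ses i p -> Ext1_vanishes A -> Ext1_vanishes C -> Ext1_vanishes B.
Proof.
move=> [inji exip surjp] extA extC Q X Y j q prQ [injj exjq surjq] h.
have surjpq : surjective (p \o q).
  by move=> z; have [y <-] := surjp z; have [x <-] := surjq y; exists x.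
have [Y' [u sesu]] := kernel_ses (p \o q) surjpq.
have [inju exu _] := sesu.
have [y|q' q'E] := factor_injection i (q \o u) inji.
  by apply/exip; apply: (exact_comp0 exu).
have [x|j' j'E] := factor_injection u j inju.
  by apply/exu; rewrite /= (exact_comp0 exjq) linear0.
have sesj : ses j' q'.
  split=> [x y jxy|y|a]; first by apply: injj; rewrite -!j'E jxy.
    split=> [q'y|[x <-]].
      have /exjq[x xE] : q (u y) = 0 by rewrite -[LHS]q'E q'y linear0.
      by exists x; apply: inju; rewrite j'E.
    by apply: (linear_inj0 inji); rewrite q'E /= j'E (exact_comp0 exjq).
  have [y yE] := surjq (i a).
  have /exu[y' y'E] : (p \o q) y = 0 by rewrite /= yE (exact_comp0 exip).
  by exists y'; apply: inji; rewrite q'E /= y'E.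
have [k kE] := extA Q X Y' j' q' prQ sesj h.
have [k' k'E] := extC Q Y' Y u _ prQ sesu k.
by exists k' => x; rewrite -j'E k'E.
Qed.

(** The class of all extensions of two Gorenstein projective modules satisfies
    the hypotheses of [Gproj_coinduction]: the horseshoe construction resolves B
    by PA x PC on the left, because PC is projective, and embeds B in PA x PC
    on the right, because Ext^1(C, PA) = 0; in both cases the new kernel or
    cokernel is an extension of the old ones. *)
Lemma Gproj_extension {A B C} (i : {linear A -> B}) (p : {linear B -> C}) :
  ses i p -> Gorenstein_projective A -> Gorenstein_projective C ->
  Gorenstein_projective B.
Proof.
move=> sesip GA GC.
apply: (Gproj_coinduction (fun B => exists A C (i : {linear A -> B})
  (p : {linear B -> C}), [/\ Gorenstein_projective A,
    Gorenstein_projective C & ses i p])); last by exists A, C, i, p.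
- move=> {sesip GA GC i p}B [A' [C' [i [p [GA GC sesip]]]]].
  by apply: (Ext1_extension sesip); apply: Gproj_Ext1.
- move=> {A B C sesip GA GC i p}B [A [C [i [p [GA GC [inji exip surjp]]]]]].
  have [KA [PA [iA [pA [GKA prPA [injA exA surjA] _]]]]] := Gproj_left GA.
  have [KC [PC [iC [pC [GKC prPC [injC exC surjC] _]]]]] := Gproj_left GC.
  have [s sE] := prPC _ _ p pC surjp.
  pose q : {linear (PA * PC)%type -> B} := ((i \o pA) \o fst) \+ (s \o snd).
  have surjq : surjective q.
    move=> b; have [y yE] := surjC (p b).
    have /exip[a aE] : p (b - s y) = 0 by rewrite linearB sE yE subrr.
    by have [x xE] := surjA a; exists (x, y); rewrite /= xE aE subrK.
  have [K [k sesk]] := kernel_ses q surjq; have [injk exk _] := sesk.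
  have [inl inlE] := linear_pair iA (\0 : {linear KA -> PC}).
  have [x|alpha alphaE] := factor_injection k inl injk.
    by apply/exk; rewrite inlE /= (exact_comp0 exA) !linear0 addr0.
  have [z|beta betaE] := factor_injection iC (snd \o k) injC.
    apply/exC; rewrite /= -sE; have := congr1 p (exact_comp0 exk z).
    by rewrite linear0 linearD (exact_comp0 exip) add0r.
  exists K, (PA * PC)%type, k, q; split=> //; last exact: projective_prod.
  exists KA, KC, alpha, beta; split=> //; split.
  + by move=> x y xy; apply: injA; move: (congr1 k xy); rewrite !alphaE !inlE => -[].
  + move=> z; split=> [bz|[x <-]]; last first.
      by apply: (linear_inj0 injC); rewrite betaE /= alphaE inlE.
    have kz2 : (k z).2 = 0 by rewrite -[LHS]betaE bz linear0.
    have /(linear_inj0 inji)/exA[x xE] : i (pA (k z).1) = 0.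
      by rewrite -[RHS](exact_comp0 exk z) /= kz2 linear0 addr0.
    exists x; apply: injk; rewrite alphaE inlE xE /= -kz2.
    by case: (k z).
  + move=> w; have /exip[a aE] : p (s (iC w)) = 0.
      by rewrite sE (exact_comp0 exC).
    have [x xE] := surjA a.
    have /exk[z zE] : q (- x, iC w) = 0 by rewrite /= !linearN xE aE addNr.
    by exists z; apply: injC; rewrite betaE /= zE.
- move=> {A B C sesip GA GC i p}B [A [C [i [p [GA GC [inji exip surjp]]]]]].
  have [PA [CA [iA [pA [GCA prPA [injA exA surjA]]]]]] := Gproj_right GA.
  have [PC [CC [iC [pC [GCC prPC [injC exC surjC]]]]]] := Gproj_right GC.
  have [//|t tE] := Gproj_Ext1 _ GC PA A B i p prPA _ iA.
  have [j jE] := linear_pair t (iC \o p).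
  have injj : injective j.
    apply: linear_injP => b; rewrite jE => -[tb /(linear_inj0 injC)/exip[a aE]].
    by move: tb; rewrite -aE tE => /(linear_inj0 injA) ->; rewrite linear0.
  have [D [d sesd]] := cokernel_ses j injj; have [_ exd surjd] := sesd.
  have [inl inlE] := linear_pair (idfun : {linear PA -> PA}) (\0 : {linear PA -> PC}).
  have inlj a : inl (iA a) = j (i a).
    by rewrite inlE jE tE /= (exact_comp0 exip) linear0.
  have [x /exA[a <-]|alpha alphaE] := factor_surjection pA (d \o inl) surjA.
    by rewrite /= inlj (exact_comp0 exd).
  have [x /exd[b <-]|beta betaE] := factor_surjection d (pC \o snd) surjd.
    by rewrite jE /= (exact_comp0 exC).
  exists (PA * PC)%type, D, j, d; split=> //; last exact: projective_prod.
  exists CA, CC, alpha, beta; split=> //; split.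
  + apply: linear_injP => w; have [x <-] := surjA w.
    rewrite alphaE => /exd[b]; rewrite jE inlE => -[tb].
    move=> /(linear_inj0 injC)/exip[a aE]; rewrite -tb -aE tE.
    exact: (exact_comp0 exA).
  + move=> v; have [z <-] := surjd v; rewrite betaE /=.
    split=> [/exC[c cE]|[w]].
      have [b bE] := surjp c; exists (pA (z.1 - t b)).
      rewrite alphaE /= -[RHS]subr0 -(exact_comp0 exd b) -linearB jE inlE.
      by congr (d _); case: z cE => z1 z2 /= cE; congr pair; rewrite /= bE cE subrr.
    have [x <-] := surjA w; rewrite alphaE /= => /eqP; rewrite -subr_eq0 -linearB.
    move=> /eqP/exd[b]; rewrite inlE jE => /(congr1 snd) /= /eqP.
    by rewrite sub0r -eqr_oppLR => /eqP <-; rewrite linearN (exact_comp0 exC) oppr0.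
  + move=> w; have [y <-] := surjC w; exists (d (0, y)).
    by rewrite betaE.
Qed.

Lemma Gproj_intro {K P P' A C} (i : {linear K -> P}) (p : {linear P -> A})
    (i' : {linear A -> P'}) (p' : {linear P' -> C}) :
  Ext1_vanishes A ->
  ses i p -> projective P -> Gorenstein_projective K ->
  ses i' p' -> projective P' -> Gorenstein_projective C ->
  Gorenstein_projective A.
Proof.
move=> extA sesip prP GK sesip' prP' GC.
pose X M := [/\ Ext1_vanishes M,
  exists K P (i : {linear K -> P}) (p : {linear P -> M}),
     [/\ Gorenstein_projective K, projective P & ses i p] &
  exists P C (i : {linear M -> P}) (p : {linear P -> C}),
     [/\ Gorenstein_projective C, projective P & ses i p]].
have GX M : Gorenstein_projective M -> X M.
  move=> GM; split; [exact: Gproj_Ext1 | | exact: Gproj_right].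
  by have [L [Q [j [q [GL prQ ex _]]]]] := Gproj_left GM; exists L, Q, j, q.
have : X A by split=> //; [exists K, P, i, p | exists P', C, i', p'].
move: A {i p i' p' sesip sesip' extA}; apply: Gproj_coinduction => M.
- by case.
- case=> _ [L [Q [j [q [GL prQ ex]]]]] _.
  by exists L, Q, j, q; split=> //; apply: GX.
- case=> _ _ [L [Q [j [q [GL prQ ex]]]]].
  by exists L, Q, j, q; split=> //; apply: GX.
Qed.

(** Resolving A through A x P, on either side, replaces the Gorenstein
    projective kernel or cokernel by an extension of it with P. *)
Lemma Gproj_summand {A P} : projective P ->
  Gorenstein_projective (A * P)%type -> Gorenstein_projective A.
Proof.
move=> prP G.
have GP := projective_Gproj _ prP.
have [K1 [Q [k0 [q0 [GK1 prQ [injk0 exk0 surjq0] _]]]]] := Gproj_left G.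
have [Q' [Z [i0 [z0 [GZ prQ' [inji0 exi0 surjz0]]]]]] := Gproj_right G.
have [inl inlE] := linear_pair (idfun : {linear A -> A}) (\0 : {linear A -> P}).
have [inr inrE] := linear_pair (\0 : {linear P -> A}) (idfun : {linear P -> P}).
have extA : Ext1_vanishes A.
  move=> N X Y j q prN [injj exjq surjq] h.
  have [j' j'E] := linear_pair j (\0 : {linear X -> P}).
  have [q' q'E] := linear_pair (q \o fst : {linear (Y * P)%type -> A}) snd.
  have sesj : ses j' q'.
    split=> [x y|[y z]|[a z]].
    - by rewrite !j'E => -[] /injj.
    - rewrite q'E; split=> [[/exjq[x xE] ->]|[x]].
        by exists x; rewrite j'E xE.
      by rewrite j'E => -[<- <-]; rewrite /= (exact_comp0 exjq).
    - by have [y yE] := surjq a; exists (y, z); rewrite q'E /= yE.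
  have [k kE] := Gproj_Ext1 _ G N X _ j' q' prN sesj h.
  have [inY inYE] :=
    linear_pair (idfun : {linear Y -> Y}) (\0 : {linear Y -> P}).
  by exists (k \o inY) => x; rewrite -kE /= inYE j'E.
have surjq : surjective (fst \o q0).
  by move=> a; have [x xE] := surjq0 (a, 0); exists x; rewrite /= xE.
have [K [k sesk]] := kernel_ses (fst \o q0) surjq; have [injk exk _] := sesk.
have GK : Gorenstein_projective K.
  have [x|alpha alphaE] := factor_injection k k0 injk.
    by apply/exk; rewrite /= (exact_comp0 exk0).
  apply: (Gproj_extension alpha (snd \o (q0 \o k))) => //; split.
  - by move=> x y xy; apply: injk0; rewrite -!alphaE xy.
  - move=> z; split=> /= [z2|[x <-]]; last by rewrite alphaE (exact_comp0 exk0).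
    have /exk0[x xE] : q0 (k z) = 0.
      by have := exact_comp0 exk z; move: z2 => /=; case: (q0 _) => ? ? /= -> ->.
    by exists x; apply: injk; rewrite alphaE.
  - move=> y; have [x xE] := surjq0 (0, y).
    by have /exk[z zE] : (fst \o q0) x = 0; [rewrite /= xE | exists z; rewrite /= zE xE].
have inji : injective (i0 \o inl).
  by move=> x y /inji0; rewrite !inlE => -[].
have [C [c sesc]] := cokernel_ses (i0 \o inl) inji; have [_ exc surjc] := sesc.
apply: (Gproj_intro k _ _ c extA sesk prQ GK sesc prQ').
have [y /exc[x <-]|beta betaE] := factor_surjection c z0 surjc.
  by rewrite /= (exact_comp0 exi0).
apply: (Gproj_extension (c \o (i0 \o inr)) beta) => //; split.
- apply: linear_injP => y /exc[a] /inji0.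
  by rewrite inlE inrE => -[].
- move=> w; split=> [|[y <-]]; last by rewrite betaE (exact_comp0 exi0).
  have [z <-] := surjc w; rewrite betaE => /exi0[[a y] <-]; exists y.
  rewrite /= -[LHS]add0r -(exact_comp0 exc a) /= -!linearD; congr (c (i0 _)).
  by rewrite inlE inrE; congr pair; rewrite /= ?addr0 ?add0r.
- by move=> w; have [z <-] := surjz0 w; exists (c z).
Qed.

(** If K is a Gorenstein projective kernel of a projective cover P -> C, then
    A x P is the pullback of B -> C along P -> C, hence an extension of B by K,
    and [Gproj_summand] removes P. *)
Lemma Gproj_kernel {A B C} (i : {linear A -> B}) (p : {linear B -> C}) :
  ses i p -> Gorenstein_projective B -> Gorenstein_projective C ->
  Gorenstein_projective A.
Proof.
move=> [inji exip surjp] GB GC.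
have [K [P [k [q [GK prP [injk exkq surjq] _]]]]] := Gproj_left GC.
have [phi phiE] := prP _ _ p q surjp.
apply: (Gproj_summand prP).
pose f : {linear (A * P)%type -> B} := (i \o fst) \+ (phi \o snd).
have [x|g gE] := factor_injection i (phi \o k) inji.
  by apply/exip; rewrite /= phiE (exact_comp0 exkq).
have [u uE] := linear_pair (\- g) k.
apply: (Gproj_extension u f) => //; split.
- by move=> x y; rewrite !uE => -[_ /injk].
- move=> [a y]; split=> [/= ay|[x <-]]; last first.
    by rewrite uE /= linearN gE addNr.
  have /exkq[x xE] : q y = 0.
    rewrite -phiE -[LHS]add0r -[X in X + _](exact_comp0 exip a).
    by rewrite -linearD ay linear0.
  exists x; rewrite uE xE; congr pair; apply: inji.
  by rewrite linearN gE /= xE; apply/eqP; rewrite eq_sym -addr_eq0 ay.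
- move=> b; have [y yE] := surjq (p b).
  have /exip[a aE] : p (b - phi y) = 0 by rewrite linearB phiE yE subrr.
  by exists (a, y); rewrite /= aE subrK.
Qed.

(** Embed G in a projective Q with Gorenstein projective cokernel N.  The
    pushout X of P and Q under G is an extension of N by P, so it is Gorenstein
    projective; it is also an extension of M by Q, which splits because
    Ext^1(M, Q) = 0.  So M x Q is Gorenstein projective. *)
Lemma Gproj_cokernel {G P M} (i : {linear G -> P}) (p : {linear P -> M}) :
  ses i p -> projective P -> Gorenstein_projective G -> Ext1_vanishes M ->
  Gorenstein_projective M.
Proof.
move=> [inji exip surjp] prP GG extM.
have [Q [N [j [q [GN prQ [injj exjq surjq]]]]]] := Gproj_right GG.
have [u uE] := linear_pair i j.
have inju : injective u by move=> x y; rewrite !uE => -[/inji].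
have [X [d [_ exd surjd]]] := cokernel_ses u inju.
have [inP inPE] := linear_pair (idfun : {linear P -> P}) (\0 : {linear P -> Q}).
have [inQ inQE] := linear_pair (\0 : {linear Q -> P}) (idfun : {linear Q -> Q}).
have [z /exd[x <-]|toN toNE] := factor_surjection d (q \o snd) surjd.
  by rewrite uE /= (exact_comp0 exjq).
have [z /exd[x <-]|toM toME] := factor_surjection d (p \o fst) surjd.
  by rewrite uE /= (exact_comp0 exip).
have GX : Gorenstein_projective X.
  apply: (Gproj_extension (d \o inP) toN) => //; last exact: projective_Gproj.
  split.
  - apply: linear_injP => y /exd[x]; rewrite uE inPE => -[<-].
    by move=> /(linear_inj0 injj) ->; rewrite linear0.
  - move=> w; split=> [|[y <-]]; last by rewrite toNE /= inPE linear0.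
    have [[y z] <-] := surjd w; rewrite toNE => /exjq[x /= xE].
    exists (y - i x); rewrite /= -[RHS]subr0 -(exact_comp0 exd x) -linearB.
    by congr (d _); rewrite inPE uE; congr pair; rewrite /= xE subrr.
  - by move=> w; have [z <-] := surjq w; exists (d (0, z)); rewrite toNE.
have sesQ : ses (d \o inQ) toM.
  split.
  - apply: linear_injP => y /exd[x]; rewrite uE inQE => -[+ <-].
    by move=> /(linear_inj0 inji) ->; rewrite linear0.
  - move=> w; split=> [|[y <-]]; last by rewrite toME /= inQE linear0.
    have [[y z] <-] := surjd w; rewrite toME => /exip[x /= xE].
    exists (z - j x); rewrite /= -[RHS]subr0 -(exact_comp0 exd x) -linearB.
    by congr (d _); rewrite inQE uE; congr pair; rewrite /= xE subrr.
  - by move=> w; have [z <-] := surjp w; exists (d (z, 0)); rewrite toME.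
have [r rE] := extM Q Q X _ toM prQ sesQ (idfun : {linear Q -> Q}).
have [f fE] := linear_pair toM r; have [_ exQ surjM] := sesQ.
have injf : injective f.
  apply: linear_injP => v; rewrite fE => -[/exQ[y <-]].
  by rewrite rE => /= ->; rewrite !linear0.
have surjf : surjective f.
  move=> [m y]; have [v vE] := surjM m.
  exists (v + (d \o inQ) (y - r v)).
  by rewrite fE (linearD toM) (linearD r) (exact_comp0 exQ) rE vE addr0 /= addrC subrK.
have [g [fg gf]] := inverse_linear f injf surjf.
apply: (Gproj_summand prQ); apply: (iso_Gorenstein_projective g) => //.
  exact: can_inj gf.
by move=> x; exists (f x).
Qed.

(** * Isomorphisms, split sequences and pullbacks *)

Definition iso A B : Prop := exists f : {linear A -> B}, injective f /\ surjective f.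

Lemma iso_sym A B : iso A B -> iso B A.
Proof.
move=> [f [injf surjf]]; have [g [fg gf]] := inverse_linear f injf surjf.
by exists g; split=> [|x]; [apply: can_inj gf | exists (f x)].
Qed.

Lemma iso_Gproj M N : iso M N -> Gorenstein_projective N -> Gorenstein_projective M.
Proof. by move=> [f [injf surjf]]; apply: iso_Gorenstein_projective injf surjf. Qed.

Lemma ses_unique {A A' B C C'} {i : {linear A -> B}} {p : {linear B -> C}}
    {i' : {linear A' -> B}} {p' : {linear B -> C'}} :
  ses i p -> ses i' p' ->
  (forall y, (exists x, i x = y) <-> exists x, i' x = y) ->
  iso A A' /\ iso C C'.
Proof.
move=> [inji exip surjp] [inji' exip' surjp'] im.
have [x|f fE] := factor_injection i' i inji'; first by apply/im; exists x.
have [y /exip/im/exip' //|g gE] := factor_surjection p p' surjp.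
split; [exists f | exists g]; split.
- by move=> x y xy; apply: inji; rewrite -!fE xy.
- move=> y; have /im[x xE] : exists z, i' z = i' y by exists y.
  by exists x; apply: inji'; rewrite fE.
- apply: linear_injP => z; have [y <-] := surjp z.
  by rewrite gE => /exip'/im/exip.
- by move=> z; have [y <-] := surjp' z; exists (p y).
Qed.

Lemma split_ses {A B C} {i : {linear A -> B}} {p : {linear B -> C}} :
  ses i p -> projective C -> iso (A * C)%type B.
Proof.
move=> [inji exip surjp] prC.
have [s sE] := prC _ _ p (idfun : {linear C -> C}) surjp.
exists ((i \o fst) \+ (s \o snd)); split.
  apply: linear_injP => -[x y] /= xy0.
  have y0 : y = 0.
    have := congr1 p xy0.
    by rewrite linearD (exact_comp0 exip) sE linear0 add0r.
  move: xy0; rewrite y0 linear0 addr0 => /(linear_inj0 inji) ->.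
  by [].
move=> b; have /exip[x xE] : p (b - s (p b)) = 0 by rewrite linearB sE subrr.
by exists (x, p b); rewrite /= xE subrK.
Qed.

(** The two sequences through the fibre product of P and P' over M are what
    Schanuel's lemma compares. *)
Lemma pullback {K P M K' P'} {i : {linear K -> P}} {p : {linear P -> M}}
    {i' : {linear K' -> P'}} {p' : {linear P' -> M}} :
  ses i p -> ses i' p' ->
  exists X (u : {linear K' -> X}) (v : {linear X -> P})
    (u' : {linear K -> X}) (v' : {linear X -> P'}), ses u v /\ ses u' v'.
Proof.
move=> [inji exip surjp] [inji' exip' surjp'].
pose q : {linear (P * P')%type -> M} := (p \o fst) \- (p' \o snd).
have [X [x [injx imx]]] := submodule_embedding _ _ (kernel_submodule _ _ q).
have xE z : p (x z).1 = p' (x z).2.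
  by apply/eqP; rewrite -subr_eq0; apply/eqP/imx; exists z.
have xP y y' : p y = p' y' -> exists z, x z = (y, y').
  by move=> yy'; apply/imx; rewrite /= yy' subrr.
have [inl inlE] := linear_pair i (\0 : {linear K -> P'}).
have [inr inrE] := linear_pair (\0 : {linear K' -> P}) i'.
have [y|u uE] := factor_injection x inr injx.
  by rewrite inrE; apply: xP; rewrite (exact_comp0 exip') linear0.
have [y|u' u'E] := factor_injection x inl injx.
  by rewrite inlE; apply: xP; rewrite (exact_comp0 exip) linear0.
exists X, u, (fst \o x), u', (snd \o x); split; split.
- by move=> y z yz; have := uE y; rewrite yz uE !inrE => -[/inji'].
- move=> z; split=> [z1|[y <-]]; last by rewrite /= uE inrE.
  have := xE z; rewrite [(x z).1]z1 linear0 => /esym/exip'[y yE].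
  exists y; apply: injx; rewrite uE inrE yE; move: z1 => /=.
  by case: (x z) => ? ? /= ->.
- by move=> y; have [y' /esym/xP[z zE]] := surjp' (p y); exists z; rewrite /= zE.
- by move=> y z yz; have := u'E y; rewrite yz u'E !inlE => -[/inji].
- move=> z; split=> [z2|[y <-]]; last by rewrite /= u'E inlE.
  have := xE z; rewrite [(x z).2]z2 linear0 => /exip[y yE].
  exists y; apply: injx; rewrite u'E inlE yE; move: z2 => /=.
  by case: (x z) => ? ? /= ->.
- by move=> y; have [y' /xP[z zE]] := surjp (p' y); exists z; rewrite /= zE.
Qed.

(** * Finite generation and coordinates on projective modules *)

Lemma finitely_generatedP M :
  finitely_generated M <-> exists m (f : {linear 'rV[R]_m -> M}), surjective f.
Proof.
split=> [[m [e eP]]|[m [f surjf]]]; exists m.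
  have [f fE] := linear_of_row e; exists f => x; have [c ->] := eP x.
  by exists (\row_i c i); rewrite fE; apply: eq_bigr => i _; rewrite mxE.
exists (fun i => f (delta_mx ord0 i)) => x; have [v <-] := surjf x.
exists (v ord0); rewrite [v in LHS]row_sum_delta linear_sum.
by apply: eq_bigr => i _; rewrite linearZ.
Qed.

Lemma finitely_generated_surj {A B} (f : {linear A -> B}) :
  surjective f -> finitely_generated A -> finitely_generated B.
Proof.
move=> surjf /finitely_generatedP[m [g surjg]]; apply/finitely_generatedP.
exists m, (f \o g) => y; have [x <-] := surjf y; have [v <-] := surjg x.
by exists v.
Qed.

Lemma finitely_generated_row m : finitely_generated 'rV[R]_m.
Proof. by apply/finitely_generatedP; exists m, idfun => v; exists v. Qed.

Lemma row_prod m k : iso 'rV[R]_(m + k) ('rV[R]_m * 'rV[R]_k)%type.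
Proof.
have [f fE] := linear_pair (lsubmx : {linear 'rV[R]_(m + k) -> _})
  (rsubmx : {linear 'rV[R]_(m + k) -> _}).
exists f; split=> [u v|[u v]].
  by rewrite !fE => -[uvl uvr]; rewrite -[u]hsubmxK uvl uvr hsubmxK.
by exists (row_mx u v); rewrite fE; congr pair; rewrite /= ?row_mxKl ?row_mxKr.
Qed.

Lemma finitely_generated_prod {A B} : finitely_generated A ->
  finitely_generated B -> finitely_generated (A * B)%type.
Proof.
move=> /finitely_generatedP[m [f surjf]] /finitely_generatedP[k [g surjg]].
have [h [_ surjh]] := row_prod m k.
have [fg fgE] := linear_pair (f \o fst : {linear ('rV[R]_m * 'rV[R]_k)%type -> A})
  (g \o snd).
apply: (finitely_generated_surj (fg \o h)); last exact: finitely_generated_row.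
move=> [x y]; have [u uE] := surjf x; have [v vE] := surjg y.
by have [w wE] := surjh (u, v); exists w; rewrite /= wE fgE /= uE vE.
Qed.

(** The free module on the underlying set of P is the module of functions
    P -> R of finite support, and its canonical map to P sends f to the
    combination of all z with coefficients f z.  A section of this map is a
    system of coordinates on P. *)
Section FreeModule.
Variable P : lmodType R.

Definition supported (f : P -> R^o) (s : seq P) : Prop :=
  forall z, z \notin s -> f z = 0.

Definition combination (f : P -> R^o) (s : seq P) : P := \sum_(z <- s) f z *: z.

(** Points outside the support contribute nothing, so any finite set of points
    that carries f computes the same combination. *)
Lemma combination_indep (f : P -> R^o) (s t : seq P) :
  uniq s -> uniq t -> supported f s -> supported f t ->
  combination f s = combination f t.
Proof.
have drop0 r : combination f r = \sum_(z <- [seq z <- r | f z != 0]) f z *: z.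
  rewrite big_filter big_mkcond; apply: eq_bigr => z _.
  by case: eqP => [->|//]; rewrite scale0r.
have memf r : supported f r -> forall z, (z \in [seq z <- r | f z != 0]) = (f z != 0).
  move=> rf z; rewrite mem_filter; case: (boolP (z \in r)) => [|/rf ->].
    by rewrite andbT.
  by rewrite eqxx.
move=> us ut sf tf; rewrite !drop0; apply: perm_big; apply: uniq_perm.
- exact: filter_uniq.
- exact: filter_uniq.
- by move=> z; rewrite !memf.
Qed.

Lemma finite_support_submodule :
  is_submodule (P -> R^o) (fun f => exists s, supported f s).
Proof.
split; first by exists [::].
move=> a f g [s sf] [t tg]; exists (s ++ t) => z.
rewrite mem_cat negb_or => /andP[/sf fz /tg gz].
by rewrite /= [LHS](_ : _ = a *: f z + g z) // fz gz scaler0 addr0.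
Qed.

Lemma projective_coordinates : projective P ->
  exists coord : {linear P -> (P -> R^o)},
    (forall x, exists s, supported (coord x) s) /\
    forall x s, uniq s -> supported (coord x) s -> combination (coord x) s = x.
Proof.
move=> prP; have [K [i [inji imi]]] := submodule_embedding _ _ finite_support_submodule.
have fini c : exists s, supported (i c) s by apply/imi; exists c.
(* The canonical map from finitely supported functions to P, as a relation. *)
pose T c y := exists s, [/\ uniq s, supported (i c) s & combination (i c) s = y].
have Tcomb c s y : T c y -> uniq s -> supported (i c) s -> combination (i c) s = y.
  by move=> [t [ut tc <-]] us sc; apply: combination_indep.
have [c|a c c' y y' Ty Ty'|y [s [_ _ <-]]|pi piE] := linear_of_relation _ _ T.
- have [s sc] := fini c; exists (combination (i c) (undup s)), (undup s).
  by split=> //; [apply: undup_uniq | move=> z; rewrite mem_undup; apply: sc].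
- have [[s sc] [t tc]] := (fini c, fini c'); pose r := undup (s ++ t).
  have rc : supported (i c) r.
    by move=> z; rewrite mem_undup mem_cat negb_or => /andP[/sc].
  have rc' : supported (i c') r.
    by move=> z; rewrite mem_undup mem_cat negb_or => /andP[_ /tc].
  have iE z : i (a *: c + c') z = a * i c z + i c' z by rewrite linearP.
  exists r; split; first exact: undup_uniq.
    by move=> z zr; rewrite iE rc // rc' // mulr0 addr0.
  rewrite -(Tcomb _ r _ Ty) ?undup_uniq // -(Tcomb _ r _ Ty') ?undup_uniq //.
  rewrite /combination scaler_sumr -big_split; apply: eq_bigr => z _ /=.
  by rewrite iE scalerDl scalerA.
- by rewrite /combination big1 // => z _; rewrite linear0 scale0r.
have surjpi : surjective pi.
  move=> y; have /imi[c cE] : exists s, supported (fun z => (z == y)%:R) s.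
    by exists [:: y] => z; rewrite inE => /negPf ->.
  exists c; apply/piE; exists [:: y]; split=> //; rewrite cE.
    by move=> z; rewrite inE => /negPf ->.
  by rewrite /combination big_seq1 eqxx scale1r.
have [s sE] := prP _ _ pi (idfun : {linear P -> P}) surjpi.
exists (i \o s); split=> [x|x r ur rx]; first exact: fini.
by apply: Tcomb => //; apply/piE; apply: sE.
Qed.

End FreeModule.

(** The coordinates of the finitely many generators of G are supported on a
    finite set S; [alpha] records the coordinates on S and [beta] recombines
    them. *)
Lemma projective_finite_factor {G P} (j : {linear G -> P}) :
  projective P -> finitely_generated G ->
  exists m (alpha : {linear P -> 'rV[R]_m}) (beta : {linear 'rV[R]_m -> P}),
    forall x, beta (alpha (j x)) = j x.
Proof.
move=> prP [k [e eP]].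
have [coord [fin_coord comb_coord]] := projective_coordinates P prP.
have [s sE] := choice (fun l => fin_coord (j (e l))).
pose S := undup (flatten [seq s l | l <- enum 'I_k]).
have [alpha alphaE] := linear_of_function P 'rV[R]_(size S)
  (fun x => \row_l coord x (nth 0 S l))
  ltac:(by move=> a x y; apply/rowP => l; rewrite !mxE linearP).
have [beta betaE] := linear_of_row (fun l : 'I_(size S) => nth 0 S l).
exists (size S), alpha, beta => x.
(* Off S the coordinates of j (e l) vanish, so summing over S recovers it. *)
have fix_gen l : beta (alpha (j (e l))) = j (e l).
  rewrite betaE -[RHS](comb_coord _ S) ?undup_uniq //.
    rewrite /combination (big_nth 0) big_mkord.
    by apply: eq_bigr => i _; rewrite alphaE mxE.
  move=> z; rewrite mem_undup => zS; apply: sE; apply: contra zS => zl.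
  by apply/flatten_mapP; exists l; rewrite ?mem_enum.
have [c ->] := eP x; rewrite !linear_sum; apply: eq_bigr => l _.
by rewrite !linearZ /= fix_gen.
Qed.

(** Embed G in a projective P with Gorenstein projective cokernel D and
    compress P to R^m by [projective_finite_factor].  A map G -> Q extends to P
    because Ext^1(D, Q) = 0, hence to R^m through [beta]; so Ext^1(C, Q) = 0 and
    [Gproj_cokernel] applies. *)
Lemma Gproj_embedding_row {G} : finitely_generated G -> Gorenstein_projective G ->
  exists m C (i : {linear G -> 'rV[R]_m}) (p : {linear 'rV[R]_m -> C}),
    [/\ ses i p, finitely_generated C & Gorenstein_projective C].
Proof.
move=> fgG GG; have [P [D [j [q [GD prP sesj]]]]] := Gproj_right GG.
have [m [alpha [beta abE]]] := projective_finite_factor j prP fgG.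
have [injj _ _] := sesj.
have inji : injective (alpha \o j).
  by move=> x y xy; apply: injj; rewrite -abE -[RHS]abE; congr (beta _).
have [C [p sesp]] := cokernel_ses (alpha \o j) inji.
have [_ _ surjp] := sesp.
exists m, C, (alpha \o j), p; split=> //.
  exact: finitely_generated_surj surjp (finitely_generated_row m).
apply: (Gproj_cokernel (alpha \o j) p) => //; first exact: row_projective.
apply: (Ext1_of_presentation (row_projective m) sesp) => Q prQ h.
have [k kE] := Gproj_Ext1 _ GD Q G P j q prQ sesj h.
by exists (k \o beta) => x /=; rewrite abE kE.
Qed.

(** * Finite presentations and coherence *)

(** Recursive form of k-presentation, suited to induction on syzygies. *)
Fixpoint presented (k : nat) M : Prop :=
  if k is k'.+1 then
    exists m K (i : {linear K -> 'rV[R]_m}) (p : {linear 'rV[R]_m -> M}),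
      ses i p /\ presented k' K
  else finitely_generated M.

Lemma presented_iso {k M N} : iso M N -> presented k M -> presented k N.
Proof.
move=> [f [injf surjf]]; case: k => [|k] /=; first exact: finitely_generated_surj.
move=> [m [K [i [p [[inji exip surjp] presK]]]]].
exists m, K, i, (f \o p); split=> //; split=> // [y|z].
  by rewrite -exip; split=> [/(linear_inj0 injf)|/= ->]; rewrite ?linear0.
by have [x <-] := surjf z; have [y <-] := surjp x; exists y.
Qed.

Lemma presentedW {k M} : presented k.+1 M -> presented k M.
Proof.
elim: k M => [|k IHk] M [m [K [i [p [[inji exip surjp] presK]]]]].
  exact: finitely_generated_surj surjp (finitely_generated_row m).
by exists m, K, i, p; split=> //; apply: IHk.
Qed.

Lemma presented_fg {k M} : presented k M -> finitely_generated M.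
Proof. by elim: k M => [//|k IHk] M /presentedW/IHk. Qed.

Lemma presented_add_row {k} m {K} : presented k K -> presented k (K * 'rV[R]_m)%type.
Proof.
case: k => [|k] /=.
  by move=> fgK; apply: finitely_generated_prod (finitely_generated_row m).
move=> [a [L [i [p [[inji exip surjp] presL]]]]].
have [f [injf surjf]] := row_prod a m.
have [g [fg gf]] := inverse_linear f injf surjf.
have [i' i'E] := linear_pair i (\0 : {linear L -> 'rV[R]_m}).
have [p' p'E] := linear_pair (p \o fst : {linear ('rV[R]_a * 'rV[R]_m)%type -> K}) snd.
exists (a + m)%N, L, (g \o i'), (p' \o f); split=> //; split.
- by move=> x y /(can_inj gf); rewrite !i'E => -[/inji].
- move=> v; split=> [|[x <-]]; last first.
    by rewrite /= gf i'E p'E /= (exact_comp0 exip).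
  rewrite /= p'E => -[/exip[x xE] v2]; exists x; apply: injf.
  by rewrite /= gf i'E xE; move: v2 => /=; case: (f v) => ? ? /= ->.
- move=> [x y]; have [u uE] := surjp x; have [v vE] := surjf (u, y).
  by exists v; rewrite /= vE p'E /= uE.
Qed.

(** Compose a cover of K x R^m with the projection to K: the kernel grows from
    L to an extension of R^m by L, which splits. *)
Lemma presented_cancel_row {k m K} : presented k (K * 'rV[R]_m)%type -> presented k K.
Proof.
case: k => [|k] /=.
  apply: (finitely_generated_surj (fst : {linear (K * 'rV[R]_m)%type -> K})) => x.
  by exists (x, 0).
move=> [a [L [i [p [[inji exip surjp] presL]]]]].
have surjq : surjective (fst \o p).
  by move=> x; have [v vE] := surjp (x, 0); exists v; rewrite /= vE.
have [L' [l sesl]] := kernel_ses (fst \o p) surjq; have [injl exl _] := sesl.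
exists a, L', l, (fst \o p); split=> //.
have [x|u uE] := factor_injection l i injl.
  by apply/exl; rewrite /= (exact_comp0 exip).
suff sesu : ses u (snd \o (p \o l)).
  by apply: (presented_iso (split_ses sesu (row_projective m))); apply: presented_add_row.
split.
- by move=> x y xy; apply: inji; rewrite -!uE xy.
- move=> z; split=> [z2|[x <-]]; last by rewrite /= uE (exact_comp0 exip).
  have /exip[x xE] : p (l z) = 0.
    by have := exact_comp0 exl z; move: z2 => /=; case: (p _) => ? ? /= -> ->.
  by exists x; apply: injl; rewrite uE.
- move=> y; have [v vE] := surjp (0, y).
  by have /exl[z zE] : (fst \o p) v = 0; [rewrite /= vE | exists z; rewrite /= zE vE].
Qed.

(** Schanuel's lemma: with K' the kernel of another presentation R^m' -> M,
    the modules K x R^m' and K' x R^m are isomorphic. *)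
Lemma presented_kernel {k m K M} (i : {linear K -> 'rV[R]_m})
    (p : {linear 'rV[R]_m -> M}) :
  ses i p -> presented k.+1 M -> presented k K.
Proof.
move=> sesip [m' [K' [i' [p' [sesip' presK']]]]].
have [X [u [v [u' [v' [sesuv sesuv']]]]]] := pullback sesip sesip'.
apply: (presented_cancel_row (m := m')).
apply: (presented_iso (iso_sym _ _ (split_ses sesuv' (row_projective m')))).
apply: (presented_iso (split_ses sesuv (row_projective m))).
exact: presented_add_row.
Qed.

Lemma presented_row k m : presented k 'rV[R]_m.
Proof.
elim: k m => [|k IHk] m /=; first exact: finitely_generated_row.
exists m, 'rV[R]_0, (\0 : {linear _ -> _}), (idfun : {linear _ -> _}); split=> //.
split=> [x y _|y|x]; first by rewrite (zero_row x) (zero_row y).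
  by split=> [/= ->|[x <-]] //=; exists 0.
by exists x.
Qed.

(** A resolution is cut at the kernel of F_0 -> M, which the rest resolves.  At
    n = 0 only the surjection F_0 -> M is constrained, which is why the
    recursion starts from finite generation. *)
Lemma n_presentedP n M : n_presented n M <-> presented n M.
Proof.
split.
  elim: n M => [|n IHn] M [F [del [e [freeF surje ex0 exS]]]].
    have [m [phi [psi _ psiK]]] := freeF 0%N isT.
    apply/finitely_generatedP; exists m, (e \o phi) => x.
    by have [y <-] := surje x; exists (psi y); rewrite /= psiK.
  have [m [phi [psi phiK psiK]]] := freeF 0%N isT.
  have surjep : surjective (e \o phi).
    by move=> x; have [y <-] := surje x; exists (psi y); rewrite /= psiK.
  have [K [i sesi]] := kernel_ses (e \o phi) surjep; have [inji exi _] := sesi.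
  exists m, K, i, (e \o phi); split=> //; apply: IHn.
  have {}ex0 := ex0 isT.
  have injpi : injective (phi \o i) by apply: inj_comp (can_inj phiK) inji.
  have [x|d dE] := factor_injection (phi \o i) (del 0%N) injpi.
    have /exi[y yE] : (e \o phi) (psi (del 0%N x)) = 0.
      by rewrite /= psiK (exact_comp0 ex0).
    by exists y; rewrite /= yE psiK.
  exists (fun i => F i.+1), (fun i => del i.+1), d; split.
  + by move=> j jn; apply: freeF.
  + move=> y; have /ex0[x xE] : e (phi (i y)) = 0 by apply: (exact_comp0 exi).
    by exists x; apply: injpi; rewrite dE.
  + move=> n_gt0 y; rewrite -exS //.
    by rewrite -dE; split=> [->|]; [rewrite linear0|exact: linear_inj0].
  + by move=> j jn; apply: exS.
elim: n M => [|n IHn] M.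
  move=> /finitely_generatedP[m [f surjf]].
  exists (fun=> 'rV[R]_m), (fun=> \0 : {linear _ -> _}), f; split=> // i _.
  by exists m, idfun; exists id.
move=> [m [K [i [p [[inji exip surjp] /IHn[F [del [e [freeF surje ex0 exS]]]]]]]]].
exists (prepend 'rV[R]_m F), (fun j => match j return
  {linear F j -> prepend 'rV[R]_m F j} with 0 => i \o e | j.+1 => del j end), p.
split=> //.
- by move=> [_|j]; [exists m, idfun; exists id | apply: freeF].
- move=> _ y; rewrite exip; split=> -[x <-]; last by exists (e x).
  by have [z <-] := surje x; exists z.
- move=> [|j] jn; last exact: exS.
  move=> y; rewrite -(ex0 jn) /=.
  by split=> [/(linear_inj0 inji)|->]; rewrite ?linear0.
Qed.

Lemma presented_coherent n : n_coherent R n ->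
  forall M, presented n M -> forall k, presented k M.
Proof.
move=> coh.
have step k M : presented (k + n) M -> presented (k + n).+1 M.
  elim: k M => [|k IHk] M; first by rewrite add0n -!n_presentedP; apply: coh.
  by move=> [m [K [i [p [sesip /IHk presK]]]]]; exists m, K, i, p.
move=> M presM k; have: presented (k + n) M by elim: k => [//|k /step].
by elim: n {coh step presM} => [|n IHn]; rewrite ?addn0 // addnS => /presentedW/IHn.
Qed.

(** The j-th cosyzygy N built by [Gproj_embedding_row] is j-presented, its
    presentation being given by the embeddings passed on the way and a cover of
    G.  For j = n coherence makes it arbitrarily presented, and
    [presented_kernel] descends from N to G. *)
Lemma Gproj_fg_presented {n G} : n_coherent R n ->
  finitely_generated G -> Gorenstein_projective G -> forall k, presented k G.
Proof.
move=> coh fgG GG k.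
(* The last clause records that j kernels lead from N back to G. *)
have cosyzygy j : exists N, [/\ Gorenstein_projective N, presented j N &
    forall k, presented (k + j) N -> presented k G].
  elim: j => [|j [N [GN presN presG]]]; first by exists G; split=> // i; rewrite addn0.
  have [m [C [i [p [sesip _ GC]]]]] := Gproj_embedding_row (presented_fg presN) GN.
  exists C; split=> //; first by exists m, N, i, p.
  by move=> l; rewrite addnS => /(presented_kernel i p sesip)/presG.
have [N [_ presN presG]] := cosyzygy n.
exact/presG/(presented_coherent n coh).
Qed.

(** * Gorenstein projective dimension and syzygies *)

Fixpoint Gdim_le (d : nat) M : Prop :=
  if d is d'.+1 then
    exists K G (i : {linear K -> G}) (p : {linear G -> M}),
      [/\ Gorenstein_projective G, Gdim_le d' K & ses i p]
  else Gorenstein_projective M.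

Lemma Gdim_of_resolution d M : Gproj_resolution M d -> Gdim_le d M.
Proof.
elim: d M => [|d IHd] M [G [del [e [GG G0 surje ex0 exS]]]].
  apply: (iso_Gproj _ _ _ (GG 0%N)); apply: iso_sym; exists e; split=> //.
  by apply: linear_injP => x /ex0[y <-]; rewrite [y]G0 ?linear0.
have [K [i sesi]] := kernel_ses e surje; have [inji exi _] := sesi.
exists K, (G 0%N), i, e; split=> //; apply: IHd.
have [x|d' d'E] := factor_injection i (del 0%N) inji.
  by apply/exi; apply: (exact_comp0 ex0).
exists (fun i => G i.+1), (fun i => del i.+1), d'; split=> //.
- by move=> j jd; apply: G0.
- move=> y; have /ex0[x xE] := exact_comp0 exi y.
  by exists x; apply: inji; rewrite d'E.
- move=> y; rewrite -exS -d'E.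
  by split=> [->|]; [rewrite linear0|exact: linear_inj0].
Qed.

Lemma resolution0 M : Gorenstein_projective M -> Gproj_resolution M 0.
Proof.
move=> GM; pose F := prepend M (fun=> 'rV[R]_0).
exists F, (fun=> \0 : {linear _ -> _}), (idfun : {linear _ -> _}); split=> //.
- by case=> [//|i]; apply/projective_Gproj/row_projective.
- by case=> [//|i] _ x; rewrite (zero_row x).
- by move=> x; exists x.
- by move=> y; split=> [/= ->|[x <-] //]; exists 0.
- by move=> i y; split=> // _; exists 0; rewrite (zero_row y).
Qed.

Lemma Gpd_finiteP M : Gpd_finite M <-> exists d, Gproj_resolution M d.
Proof.
rewrite /Gpd_finite /Gpd; case: pselect => [res|nres]; split=> //.
  by move=> _; have [d /asboolP] := res; exists d.
by move=> [d dM]; case: nres; exists d; apply/asboolP.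
Qed.

Lemma Gpd_le0P M : Gpd_le M 0 <-> Gorenstein_projective M.
Proof.
rewrite /Gpd_le /Gpd; case: pselect => [res|nres]; split=> //.
- case: ex_minnP => k /asboolP resM _; rewrite leqn0 => /eqP k0.
  by apply: (Gdim_of_resolution 0); rewrite -k0.
- by move=> GM; case: ex_minnP => k _; apply; apply/asboolP/resolution0.
- by move=> GM; case: nres; exists 0%N; apply/asboolP/resolution0.
Qed.

Lemma Gdim_iso {d M N} : iso M N -> Gdim_le d M -> Gdim_le d N.
Proof.
case: d => [|d] /=; first by move=> /iso_sym; apply: iso_Gproj.
move=> [f [injf surjf]] [K [G [i [p [GG dK [inji exip surjp]]]]]].
exists K, G, i, (f \o p); split=> //; split=> // [y|z].
  by rewrite -exip; split=> [/(linear_inj0 injf)|/= ->]; rewrite ?linear0.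
by have [x <-] := surjf z; have [y <-] := surjp x; exists y.
Qed.

(** Given 0 -> N -> H -> L -> 0, the preimage [H'] of K in H is the kernel of the
    epimorphism H -> G between Gorenstein projective modules, so it is
    Gorenstein projective, and [H'] -> K still has kernel N. *)
Lemma Gdim_kernel {d K L G} (u : {linear K -> L}) (v : {linear L -> G}) :
  ses u v -> Gorenstein_projective G -> Gdim_le d L -> Gdim_le d K.
Proof.
move=> sesuv GG; case: d => [|d] /=; first by move=> GL; apply: Gproj_kernel sesuv GL GG.
move=> [N [H [i [p [GH dN [inji exip surjp]]]]]].
have [inju exuv surjv] := sesuv.
have surjvp : surjective (v \o p).
  by move=> z; have [y <-] := surjv z; have [x <-] := surjp y; exists x.
have [H' [h sesh]] := kernel_ses (v \o p) surjvp; have [injh exh _] := sesh.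
have [x|i' i'E] := factor_injection h i injh.
  by apply/exh; rewrite /= (exact_comp0 exip) linear0.
have [x|p' p'E] := factor_injection u (p \o h) inju.
  by apply/exuv; apply: (exact_comp0 exh).
exists N, H', i', p'; split=> //; first exact: Gproj_kernel sesh GH GG.
split.
- by move=> x y xy; apply: inji; rewrite -!i'E xy.
- move=> z; split=> [z0|[x <-]].
    have /exip[x xE] : p (h z) = 0 by rewrite -[LHS]p'E z0 linear0.
    by exists x; apply: injh; rewrite i'E.
  by apply: (linear_inj0 inju); rewrite p'E /= i'E (exact_comp0 exip).
- move=> y; have [x xE] := surjp (u y).
  have /exh[z zE] : (v \o p) x = 0 by rewrite /= xE (exact_comp0 exuv).
  by exists z; apply: inju; rewrite p'E /= zE.
Qed.

Lemma Gdim_add_projective {d K P} : projective P -> Gdim_le d K -> Gdim_le d (K * P)%type.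
Proof.
move=> prP; have GP := projective_Gproj _ prP.
have Gprod G : Gorenstein_projective G -> Gorenstein_projective (G * P)%type.
  move=> GG; have [i iE] := linear_pair (idfun : {linear G -> G}) (\0 : {linear G -> P}).
  apply: (Gproj_extension i snd) => //; split.
  - by move=> x y; rewrite !iE => -[].
  - by move=> [x y]; split=> [/= ->|[z <-]]; [exists x|]; rewrite iE.
  - by move=> y; exists (0, y).
case: d => [|d] /=; first exact: Gprod.
move=> [L [G [i [p [GG dL [inji exip surjp]]]]]].
have [i' i'E] := linear_pair i (\0 : {linear L -> P}).
have [p' p'E] := linear_pair (p \o fst : {linear (G * P)%type -> K}) snd.
exists L, (G * P)%type, i', p'; split=> //; first exact: Gprod.
split.
- by move=> x y; rewrite !i'E => -[/inji].
- move=> [x y]; split=> [|[z <-]]; last by rewrite i'E p'E /= (exact_comp0 exip).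
  by rewrite p'E => -[/exip[z /= <-] ->]; exists z; rewrite i'E.
- by move=> [x y]; have [z zE] := surjp x; exists (z, y); rewrite p'E /= zE.
Qed.

(** The fibre product X of P and the first term G of a resolution of M is
    isomorphic to N x P, with N of dimension at most d, and K is the kernel of
    X -> G. *)
Lemma Gdim_syzygy {d K P M} (i : {linear K -> P}) (p : {linear P -> M}) :
  ses i p -> projective P -> Gdim_le d.+1 M -> Gdim_le d K.
Proof.
move=> sesip prP [N [G [j [q [GG dN sesjq]]]]].
have [X [u [v [u' [v' [sesuv sesuv']]]]]] := pullback sesip sesjq.
apply: (Gdim_kernel u' v' sesuv' GG).
by apply: (Gdim_iso (split_ses sesuv prP)); apply: Gdim_add_projective.
Qed.

(** Passing to the syzygy K lowers the dimension by one, so K is Gorenstein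
    projective by induction, and the closure hypothesis returns to M. *)
Lemma finite_Gdim_Gproj d M :
  (forall m K N (i : {linear K -> 'rV[R]_m}) (p : {linear 'rV[R]_m -> N}),
     ses i p -> finitely_generated K -> Gorenstein_projective K ->
     Gorenstein_projective N) ->
  presented d M -> Gdim_le d M -> Gorenstein_projective M.
Proof.
move=> closed; elim: d M => [//|d IHd] M [m [K [i [p [sesip presK]]]]] dM.
apply: (closed m K M i p sesip (presented_fg presK)); apply: IHd presK _.
exact: (Gdim_syzygy i p sesip (row_projective m) dM).
Qed.

(** * The two implications *)

Lemma ses_submodule {A B C} {i : {linear A -> B}} {p : {linear B -> C}} :
  ses i p -> exists G : submodClosed B, iso A (submod G) /\ iso C (quotmod G).
Proof.
move=> sesip; exists (bundle _ (image_submodule _ _ i)).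
apply: (ses_unique sesip (submodule_ses _ _)) => y.
rewrite -(in_bundle _ (image_submodule _ _ i)).
split=> [yG|[x <-]]; last exact: (valP x).
by exists (Sub y yG).
Qed.

(** P is only projective, so cover it by r : R^m -> P and present P / G by the
    preimage K of G.  It is an extension of G by the kernel of r, hence
    Gorenstein projective, and it is finitely generated because r splits; so K
    is itself presented to any order. *)
Lemma presented_quotmod {n} (P : lmodType R) (G : submodClosed P) :
  n_coherent R n -> finitely_generated P -> projective P ->
  finitely_generated (submod G) -> Gorenstein_projective (submod G) ->
  presented n (quotmod G).
Proof.
move=> coh /finitely_generatedP[m [r surjr]] prP /finitely_generatedP[a [g surjg]] GG.
have [injv exv surjv] := submodule_ses _ G.
pose p : {linear 'rV[R]_m -> quotmod G} := quotmod_proj G \o r.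
have surjp : surjective p.
  by move=> z; have [y <-] := surjv z; have [x <-] := surjr y; exists x.
have [K [k sesk]] := kernel_ses p surjp; have [injk exk _] := sesk.
have [x|b bE] := factor_injection (val : {linear submod G -> P}) (r \o k) injv.
  by apply/exv; apply: (exact_comp0 exk).
apply: presentedW; exists m, K, k, p; split=> //.
apply: (Gproj_fg_presented coh).
- have [s sE] := prP _ _ r (idfun : {linear P -> P}) surjr.
  (* For x in K, h (x, w) = x as soon as g w = r x; and r (h (x, w)) = g w is
     always in G. *)
  pose h : {linear ('rV[R]_m * 'rV[R]_a)%type -> 'rV[R]_m} :=
    ((idfun \- (s \o r)) \o fst) \+ ((s \o (val \o g)) \o snd).
  have rh x : r (h x) = val (g x.2).
    by rewrite /h /= linearD linearB !sE /= subrr add0r.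
  have [x|f fE] := factor_injection k h injk.
    by apply/exk; apply/exv; exists (g x.2); rewrite rh.
  apply: (finitely_generated_surj f).
    move=> z; have [w wE] := surjg (b z); exists (k z, w).
    apply: injk; rewrite fE /h /= wE; have /= -> := bE z; exact: subrK.
  exact: finitely_generated_prod (finitely_generated_row m) (finitely_generated_row a).
- have [L [l sesl]] := kernel_ses r surjr; have [injl exl _] := sesl.
  have GL : Gorenstein_projective L.
    apply: (Gproj_kernel l r sesl); apply: projective_Gproj => //.
    exact: row_projective.
  have [x|c cE] := factor_injection k l injk.
    by apply/exk; rewrite /p /= (exact_comp0 exl) linear0.
  apply: (Gproj_extension c b) => //; split.
  + by move=> x y xy; apply: injl; rewrite -!cE xy.
  + move=> z; split=> [z0|[x <-]].
      have /exl[x xE] : r (k z) = 0 by rewrite -[LHS]bE z0 linear0.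
      by exists x; apply: injk; rewrite cE.
    by apply: (linear_inj0 injv); rewrite bE /= cE (exact_comp0 exl).
  + move=> y; have [x xE] := surjr (val y).
    have /exk[z zE] : p x = 0 by apply/exv; exists y; rewrite xE.
    by exists z; apply: injv; rewrite bE /= zE.
Qed.

(** If only 0 annihilates the generators e_i, then the map R -> R^m with
    entries e_i is injective, and the Gorenstein projectivity of its cokernel
    extends the identity of R to R^m.  Evaluating the extension writes 1 as a
    combination of the e_i. *)
Lemma proper_ideal_annihilator n (I : submodClosed R^o) :
  (forall M, presented n M -> Gorenstein_projective M) ->
  finitely_generated (submod I) -> is_proper_ideal I -> has_nonzero_annihilator I.
Proof.
move=> GA [m [e eP]] [x /negP xI]; apply: contrapT => noann.
have [f fE] := linear_of_function 'rV[R]_1 'rV[R]_m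
  (fun v => \row_i (v ord0 ord0 * val (e i)))
  ltac:(by move=> a u v; apply/rowP => i; rewrite !mxE mulrDl mulrA).
have injf : injective f.
  apply: linear_injP => v fv0; apply/rowP => j; rewrite ord1 mxE.
  apply: contrapT => v_neq0; apply: noann; exists (v ord0 ord0); split=> // y yI.
  have [c cE] := eP (Sub y yI); have -> : y = val (Sub y yI : submod I) by [].
  rewrite cE linear_sum mulr_sumr big1 // => i _.
  have := congr1 (fun w : 'rV_m => w ord0 i) fv0; rewrite fE !mxE => vei.
  by rewrite linearZ /= [_ *: _]/(_ * _) mulrCA vei mulr0.
have [C [p sesp]] := cokernel_ses f injf.
have GC : Gorenstein_projective C.
  by apply/GA/presentedW; exists m, 'rV[R]_1, f, p; split=> //; apply: presented_row.
have [r rE] := Gproj_Ext1 _ GC _ _ _ f p (row_projective 1) sesp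
  (idfun : {linear 'rV[R]_1 -> 'rV[R]_1}).
apply: xI.
have one : (1 : R^o) =
    \sum_i r (delta_mx ord0 i) ord0 ord0 *: (val (e i) : R^o).
  have := congr1 (fun w : 'rV_1 => w ord0 ord0) (rE (const_mx 1)).
  rewrite /= mxE => <-; rewrite [f _]row_sum_delta linear_sum summxE.
  apply: eq_bigr => i _; rewrite linearZ /= !mxE fE !mxE mul1r.
  by rewrite [RHS]/(_ * _) mulrC.
have -> : x = x *: (1 : R^o) by rewrite /(_ *: _) /= mulr1.
have [I0 ID] := submodClosedP I.
have Iscale a y : y \in I -> a *: y \in I.
  by move=> yI; rewrite -[_ *: _]addr0; apply: ID.
apply: (Iscale); rewrite one; elim/big_ind: _ => // [y z yI zI|i _].
  by rewrite -[y]scale1r; apply: ID.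
exact/Iscale/(valP (e i)).
Qed.

End Ring.

Theorem theorem2p12 (n : nat) (R : comPzRingType) (coh : n_coherent R n) :
  G_ring R n 0 <->
  [/\ forall I : submodClosed R^o,
        finitely_generated (submod I) -> is_proper_ideal I ->
        has_nonzero_annihilator I,
      forall M : lmodType R, infinitely_presented M -> Gpd_finite M &
      forall (P : lmodType R) (G : submodClosed P),
        finitely_generated P -> projective P ->
        finitely_generated (submod G) -> Gorenstein_projective (submod G) ->
        Gorenstein_projective (quotmod G)].
Proof.
split=> [Gn0|[_ finGpd quotG] M nM].
  have GA (M : lmodType R) : presented n M -> Gorenstein_projective M.
    by move=> /n_presentedP nM; apply/Gpd_le0P; apply: Gn0.
  split=> [I|M infM|P G fgP prP fgG GG].
  - exact: (proper_ideal_annihilator n I GA).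
  - by apply/Gpd_finiteP; exists 0%N; apply/resolution0/GA/n_presentedP.
  - exact/GA/(presented_quotmod P G coh).
apply/Gpd_le0P.
have presM := presented_coherent n coh M ((n_presentedP n M).1 nM).
have [|d /Gdim_of_resolution dM] := (Gpd_finiteP M).1 (finGpd M _).
  by move=> k; apply/n_presentedP.
apply: (finite_Gdim_Gproj d M) dM => // m K N i p sesip fgK GK.
have [G [KG NG]] := ses_submodule sesip; apply: (iso_Gproj _ _ NG).
have [f [_ surjf]] := KG.
apply: quotG; [exact: finitely_generated_row | exact: row_projective | |].
  exact: finitely_generated_surj surjf fgK.
exact: iso_Gproj (iso_sym _ _ KG) GK.
Qed.
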